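(* For every integer $n\geq 3$, the augmented saltire graphs ${AS}_{n,n}$ and ${AS}_{n,n+1}$ are claw-contractible-free and their chromatic symmetric functions are not $e$-positive.
   Context: All graphs are finite and simple. For a graph $G$ with vertex set $V=\{v_1,\dots,v_N\}$, the chromatic symmetric function is $X_G=\sum_\kappa x_{\kappa(v_1)}\cdots x_{\kappa(v_N)}$, summed over all proper colourings $\kappa:V\to\{1,2,\dots\}$. The elementary symmetric functions are $e_i=\sum_{j_1<\cdots<j_i}x_{j_1}\cdots x_{j_i}$ and $e_\lambda=e_{\lambda_1}\cdots e_{\lambda_\ell}$; they form a basis of the symmetric functions. A symmetric function is $e$-positive if it is a non-negative linear combination of the $e_\lambda$. The claw is $K_{1,3}$. A graph $G$ contracts to the claw if there is a subset $S$ of its edges such that contracting the edges of $S$ and replacing multiple edges by single edges yields the claw; $G$ is claw-contractible-free if it does not contract to the claw. For $a\geq 2$, $b\geq 3$, the augmented saltire graph ${AS}_{a,b}$ is the graph on vertices $v_1,\dots,v_{a+b}$ with edges $v_iv_{i+1}$ for $1\leq i\leq a+b-1$, together with $v_{a+b}v_1$, $v_1v_{a+1}$, $v_2v_{a+2}$ and $v_1v_{a+2}$. *)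

(* Defs.v *)
From HB Require Import structures.
From mathcomp Require Import all_boot all_order all_algebra.
From mathcomp Require Import mpoly.

Set Implicit Arguments.
Unset Strict Implicit.
Unset Printing Implicit Defensive.

Import Order.TTheory GRing.Theory Num.Theory.
Local Open Scope ring_scope.

Record sgraph := SGraph {
  vertex :> finType;
  adj : rel vertex;
  adj_sym : ssrbool.symmetric adj;
  adj_irrefl : irreflexive adj
}.

Definition edges (G : sgraph) : {set {set G}} :=
  [set [set p.1; p.2] | p in [set p : G * G | adj p.1 p.2]].

Definition graph_iso (G H : sgraph) : Prop :=
  exists f : G -> H,
    bijective f /\ (forall u v : G, adj (f u) (f v) = adj u v).

(* The vertices of the contraction of G along a set S of edges are the
   connected components of the spanning subgraph (V(G), S). Two distinct
   components are adjacent when some edge of G joins them: this merges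
   multiple edges and drops the loops that edges of G outside S, but inside
   a component, would give. *)
Section Contraction.
Variables (G : sgraph) (S : {set {set G}}).

Definition components_along : {set {set G}} :=
  equivalence_partition (connect (fun u v : G => [set u; v] \in S)) [set: G].

Definition contract_vertex : finType := {A : {set G} | A \in components_along}.

Definition contract_adj : rel contract_vertex := fun A B =>
  (A != B) && [exists u in val A, exists v in val B, adj u v].

Lemma contract_adj_sym : ssrbool.symmetric contract_adj.
Proof.
move=> A B; rewrite /contract_adj eq_sym; congr (_ && _).
by apply/exists_inP/exists_inP => -[u uA /exists_inP[v vB uv]];
  exists v => //; apply/exists_inP; exists u => //; rewrite adj_sym.
Qed.

Lemma contract_adj_irrefl : irreflexive contract_adj.
Proof. by move=> A; rewrite /contract_adj eqxx. Qed.

Definition contract : sgraph := SGraph contract_adj_sym contract_adj_irrefl.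

End Contraction.

Definition contracts_to (G H : sgraph) : Prop :=
  exists2 S : {set {set G}}, S \subset edges G & graph_iso (contract S) H.

Section CompleteBipartite.
Variables m n : nat.

Definition Kbip_adj : rel ('I_m + 'I_n)%type := fun u v =>
  match u, v with
  | inl _, inr _ | inr _, inl _ => true
  | _, _ => false
  end.

Lemma Kbip_adj_sym : ssrbool.symmetric Kbip_adj. Proof. by move=> [u|u] [v|v]. Qed.

Lemma Kbip_adj_irrefl : irreflexive Kbip_adj. Proof. by move=> [u|u]. Qed.

Definition Kbip : sgraph := SGraph Kbip_adj_sym Kbip_adj_irrefl.

End CompleteBipartite.

Definition claw : sgraph := Kbip 1 3.

Definition claw_contractible_free (G : sgraph) : Prop := ~ contracts_to G claw.

(* A symmetric function in x_1, x_2, ... is represented by its images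
   f k = f(x_1, ..., x_k, 0, 0, ...) in k variables, for every k. An identity
   between symmetric functions holds iff it holds for every k. *)
Definition symfun (R : realDomainType) := forall k : nat, {mpoly R[k]}.

Definition proper_colouring (G : sgraph) (k : nat) (c : {ffun G -> 'I_k}) :=
  [forall u : G, forall v : G, adj u v ==> (c u != c v)].

Definition chromatic_symfun (R : realDomainType) (G : sgraph) : symfun R :=
  fun k => \sum_(c : {ffun G -> 'I_k} | proper_colouring c)
             \prod_(v : G) 'X_(c v).

Definition elementary (R : realDomainType) (la : seq nat) : symfun R :=
  fun k => \prod_(i <- la) @mesym k R i.

Definition is_partition (la : seq nat) : bool :=
  sorted geq la && all (leq 1) la.

Definition e_positive (R : realDomainType) (f : symfun R) : Prop :=
  exists (P : seq (seq nat)) (c : seq nat -> R),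
    [/\ uniq P, all is_partition P, forall la, la \in P -> 0 <= c la &
        forall k, f k = \sum_(la <- P) c la *: elementary R la k].

Section AugmentedSaltire.
Variables a b : nat.

(* The edges v_i v_j as listed in the definition of AS_{a,b}, with i and j
   ranging over 1, ..., a + b. *)
Definition AS_edge (i j : nat) : bool :=
  [|| j == i.+1,
      (i == a + b)%N && (j == 1%N),
      (i == 1%N) && (j == a.+1),
      (i == 2%N) && (j == a.+2) |
      (i == 1%N) && (j == a.+2)].

(* The vertex v_i is i - 1 : 'I_(a + b). The test u != v only matters outside
   the intended range a >= 2, b >= 3, where no edge listed is a loop. *)
Definition AS_adj : rel 'I_(a + b) := fun u v =>
  (u != v) && (AS_edge u.+1 v.+1 || AS_edge v.+1 u.+1).

Lemma AS_adj_sym : ssrbool.symmetric AS_adj.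
Proof. by move=> u v; rewrite /AS_adj eq_sym orbC. Qed.

Lemma AS_adj_irrefl : irreflexive AS_adj.
Proof. by move=> u; rewrite /AS_adj eqxx. Qed.

Definition AS : sgraph := SGraph AS_adj_sym AS_adj_irrefl.

End AugmentedSaltire.

(* Main.v *)
(* Not contracting to the claw: three leaf classes cannot live on two arcs. Cut
   the Hamiltonian cycle at the edges v_1 v_2 and v_(a+1) v_(a+2). Inside each of
   the two arcs the vertices have degree two, so two leaf classes on the same arc
   would enclose the class of the centre and also be separated by it on the other
   side, against its connectedness.

   Not e-positive: if X_G is e-positive then X_G takes a non-negative value on
   every alphabet on which all e_i are non-negative. Take the n + 1 numbers with
   e_n = e_(n+1) = 1 and all other e_i = 0, so that the power sums p_1, ...,
   p_(n-1) vanish. The vertices v_1, v_2, v_(a+1), v_(a+2) carry all the chords,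
   and the remaining vertices form two paths, whose colourings are summed by
   inclusion-exclusion with almost all terms zero. What remains is quadratic in
   the power sums, and both X_(AS n n) and X_(AS n (n+1)) take the value
   - n (n - 1) (n - 2). *)

Require Import Defs.
From mathcomp Require Import all_boot all_order all_algebra fingroup perm algC.
From mathcomp Require Import mpoly.
From mathcomp Require Import zify ring.

Set Implicit Arguments.
Unset Strict Implicit.
Unset Printing Implicit Defensive.

Import Order.TTheory GRing.Theory Num.Theory.

(** * Contractions as maps with connected fibres *)

Lemma edgesP (G : sgraph) (u v : G) : [set u; v] \in edges G -> adj u v.
Proof.
case/imsetP => -[x y]; rewrite inE /= => xy uvE.
have: u \in [set x; y] by rewrite -uvE set21.
have: v \in [set x; y] by rewrite -uvE set22.
have: x \in [set u; v] by rewrite uvE set21.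
have: y \in [set u; v] by rewrite uvE set22.
rewrite !inE; case: (u =P x) => [-> | _] /=.
  case/orP=> /eqP yE; last by rewrite -yE.
  by move: xy; rewrite yE adj_irrefl.
case: (x =P v) => [<- _ _ _ /eqP-> | _ _]; first by rewrite adj_sym.
rewrite orbF => /eqP xu _ /eqP uy.
by move: xy; rewrite xu uy adj_irrefl.
Qed.

(** The first step of a path that leaves [U]; both its ends are still reached from [x]. *)
Lemma connect_crossing (T : finType) (e : rel T) (U : {set T}) (x y : T) :
  x \in U -> y \notin U -> connect e x y ->
  exists u v, [/\ u \in U, v \notin U, e u v, connect e x u & connect e x v].
Proof.
move=> xU yU /connectP[p]; elim: p x xU => [|z p IHp] x xU /=.
  by move=> _ yE; rewrite yE xU in yU.
case/andP=> xz pz yE; case: (boolP (z \in U)) => zU.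
  have [u [v [uU vU uv zu zv]]] := IHp z zU pz yE.
  by exists u, v; split=> //; apply: (connect_trans (connect1 xz)).
by exists x, z; split=> //; apply: connect1.
Qed.

(** Each vertex goes to the component that contains it. Connectedness of the fibres is put in terms
    of cuts, as the arc argument applies it: a set that splits a fibre is left by an edge inside
    that fibre. *)
Lemma contracts_to_map (G H : sgraph) : contracts_to G H ->
  exists phi : G -> H,
    [/\ forall h, exists v, phi v = h,
        forall u v, adj u v -> phi u = phi v \/ adj (phi u) (phi v) &
        forall (U : {set G}) x y, x \in U -> y \notin U -> phi x = phi y ->
          exists u v,
            [/\ u \in U, v \notin U, adj u v, phi u = phi x & phi v = phi x]].
Proof.
case=> S /subsetP SE [f [[g fK gK] fadj]].
pose e : rel G := fun u v => [set u; v] \in S.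
have e_sym : connect_sym e.
  by apply: sym_connect_sym => u v; rewrite /e setUC.
have e_equiv : {in [set: G] & &, equivalence_rel (connect e)}.
  move=> u v w _ _ _; split=> [|uv]; first exact: connect0.
  exact: same_connect.
have part := equivalence_partitionP e_equiv.
have cover_e : cover (components_along S) = [set: G] by apply/eqP; case/and3P: part.
have triv_e : trivIset (components_along S) by case/and3P: part.
have s0 : set0 \notin components_along S by case/and3P: part.
have blk_in v : pblock (components_along S) v \in components_along S.
  by apply: pblock_mem; rewrite cover_e.
pose blk v : contract S := exist _ (pblock (components_along S) v) (blk_in v).
have blkE u v : (blk u = blk v) <-> connect e u v.
  rewrite -(pblock_equivalence_partition e_equiv) ?inE //.
  rewrite -eq_pblock ?cover_e //; split=> [[->] // | /eqP uv].
  exact: val_inj.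
have f_inj : injective f := can_inj fK.
exists (fun v => f (blk v)); split.
- move=> h; have gh : val (g h) \in components_along S by exact: valP.
  have [v vg] : exists v, v \in val (g h).
    by apply/set0Pn; apply: contraNneq s0 => <-.
  exists v; rewrite -[h]gK; congr f; apply: val_inj => /=.
  exact: def_pblock.
- move=> u v uv; case: (eqVneq (blk u) (blk v)) => [-> | uNv]; first by left.
  right; rewrite fadj /= /contract_adj uNv /=.
  apply/exists_inP; exists u => /=; first by rewrite mem_pblock cover_e.
  by apply/exists_inP; exists v => //=; rewrite mem_pblock cover_e.
- move=> U x y xU yU /f_inj/blkE xy.
  have [u [v [uU vU uv xu xv]]] := connect_crossing xU yU xy.
  exists u, v; split=> //; first exact: edgesP (SE _ uv).
    by congr f; apply/esym/blkE.
  by congr f; apply/esym/blkE.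
Qed.

(** * The Hamiltonian cycle and the claw *)

(** Positions on the cycle are read modulo [N], position [i] being v_(i+1), so that an arc through
    v_N and v_1 is still an interval of positions. *)
Definition cyc (N : nat) (N_gt0 : 0 < N) (i : nat) : 'I_N :=
  Ordinal (ltn_pmod i N_gt0).

Lemma cyc_inj N (N_gt0 : 0 < N) i j m :
  i <= j < i + N -> i <= m < i + N -> cyc N_gt0 j = cyc N_gt0 m -> j = m.
Proof.
move=> /andP[ij jN] /andP[im mN] /(congr1 val) /= /eqP.
have [jm|jm|-> //] := ltngtP j m; first rewrite eq_sym.
  rewrite (eqn_mod_dvd _ (ltnW jm)) => /dvdn_leq; lia.
rewrite (eqn_mod_dvd _ (ltnW jm)) => /dvdn_leq; lia.
Qed.

Lemma cyc_adjS a b (N_gt0 : 0 < a + b) (hN : 1 < a + b) i :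
  AS_adj (cyc N_gt0 i) (cyc N_gt0 i.+1).
Proof.
rewrite /AS_adj /AS_edge -val_eqE /= modnS.
have := ltn_pmod i N_gt0; have := divn_eq i (a + b).
case: ifP => [/dvdnP[q qE] | _] iE iN; last by lia.
suff iN1 : (i %% (a + b)).+1 = a + b by lia.
have : a + b %| (i %% (a + b)).+1.
  have : a + b %| i %/ (a + b) * (a + b) + (i %% (a + b)).+1.
    by rewrite addnS -iE qE dvdn_mull.
  by rewrite dvdn_addr // dvdn_mull.
by move/dvdn_leq; lia.
Qed.

(** Two different leaf classes at [i] and [j] would force the centre class to occur both between [i]
    and [j] and on the rest of the cycle. As the vertices strictly between have no other neighbours
    than those along the cycle, an edge leaving this interval ends at [i] or [j], hence in a leaf
    class, and the centre class is disconnected. *)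
Lemma arc_one_leaf a b (N_gt0 : 0 < a + b) (hN : 1 < a + b)
    (phi : AS a b -> claw) (s t : nat) :
  (forall u v, adj u v -> phi u = phi v \/ adj (phi u) (phi v)) ->
  (forall (U : {set AS a b}) x y, x \in U -> y \notin U -> phi x = phi y ->
     exists u v,
       [/\ u \in U, v \notin U, adj u v, phi u = phi x & phi v = phi x]) ->
  t < s + (a + b) ->
  (forall m (w : AS a b), s < m < t -> AS_adj (cyc N_gt0 m) w ->
     w = cyc N_gt0 m.-1 \/ w = cyc N_gt0 m.+1) ->
  forall i j p q, s <= i -> i < j -> j <= t ->
    phi (cyc N_gt0 i) = inr p -> phi (cyc N_gt0 j) = inr q -> p = q.
Proof.
set c := cyc N_gt0 => phi_adj phi_conn tN deg2.
(* Distinct leaves of the claw are not adjacent, so a walk along the cycle from one leaf class to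
   another meets the centre. *)
have walk d i p q : phi (c i) = inr p -> phi (c (i + d)) = inr q -> p != q ->
    exists2 m, i < m < i + d & phi (c m) = inl ord0.
  elim: d i p => [|d IHd] i p pi qi pq.
    by move: qi pq; rewrite addn0 pi => -[->]; rewrite eqxx.
  have := phi_adj (c i) (c i.+1) (cyc_adjS N_gt0 hN i).
  case pi1: (phi (c i.+1)) => [z | r].
    move=> _; exists i.+1; last by rewrite pi1 (ord1 z).
    case: d {IHd} qi => [|d] qi; last by lia.
    by move: pi1; rewrite -addn1 qi.
  rewrite pi => -[[pr] | //].
  have [] := IHd i.+1 r; first by rewrite pi1.
  - by rewrite addSnnS.
  - by rewrite -pr.
  by move=> m mi ?; exists m => //; lia.
move=> i j p q si ij jt ip jq; apply/eqP/negPn/negP => pq.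
have [m mij mc] : exists2 m, i < m < j & phi (c m) = inl ord0.
  by have := walk (j - i) i p q; rewrite subnKC 1?ltnW //; apply.
(* The way back from [j] to [i], around the other side of the cycle. *)
have [m' mji m'c] : exists2 m, j < m < i + (a + b) & phi (c m) = inl ord0.
  have := walk (i + (a + b) - j) j q p; rewrite subnKC; last by lia.
  apply; rewrite // 1?eq_sym // -ip; congr phi.
  by apply: val_inj; rewrite /= modnDr.
pose U : {set AS a b} := [set c l | l : 'I_(a + b + i) & i < l < j].
have inU l : i < l < j -> c l \in U.
  move=> lij; have lN : l < a + b + i by lia.
  by apply/imsetP; exists (Ordinal lN); rewrite ?inE.
have m'U : c m' \notin U.
  apply/imsetP => -[l]; rewrite inE => lij /(@cyc_inj _ _ i); lia.
have [u [v [uU vU uv uc vc]]] := phi_conn _ _ _ (inU m mij) m'U (etrans mc (esym m'c)).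
case/imsetP: uU uc uv => l; rewrite inE => lij -> lc lv.
have lst : s < l < t by lia.
case: (deg2 l v lst lv) => vE; rewrite vE in vU vc.
  case: (ltngtP i l.-1) => [il | il | il]; last by rewrite -il ip mc in vc.
    by case/negP: vU; apply: inU; lia.
  by lia.
case: (ltngtP l.+1 j) => [il | il | il]; last by rewrite il jq mc in vc.
  by case/negP: vU; apply: inU; lia.
by lia.
Qed.

(** The arcs v_2, ..., v_(a+1) and v_(a+2), ..., v_(a+b), v_1 cover the cycle, and chords meet them
    only at their ends. Each arc meets at most one leaf class, but there are three of these. *)
Lemma AS_claw_contractible_free a b : 0 < a -> 0 < b ->
  claw_contractible_free (AS a b).
Proof.
move=> a_gt0 b_gt0 /contracts_to_map[phi [phi_surj phi_adj phi_conn]].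
have N_gt0 : 0 < a + b by lia.
have hN : 1 < a + b by lia.
have arc1 : forall i j p q, 1 <= i -> i < j -> j <= a ->
    phi (cyc N_gt0 i) = inr p -> phi (cyc N_gt0 j) = inr q -> p = q.
  apply: arc_one_leaf => //; first by lia.
  move=> m w mst; rewrite /AS_adj /AS_edge -val_eqE /= modn_small; last by lia.
  have := ltn_ord w => wN mw.
  have [] : (w : nat) = m.-1 \/ (w : nat) = m.+1 by lia.
    by move=> wE; left; apply: val_inj; rewrite /= wE modn_small //; lia.
  by move=> wE; right; apply: val_inj; rewrite /= wE modn_small //; lia.
have arc2 : forall i j p q, a.+1 <= i -> i < j -> j <= a + b ->
    phi (cyc N_gt0 i) = inr p -> phi (cyc N_gt0 j) = inr q -> p = q.
  apply: arc_one_leaf => //; first by lia.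
  move=> m w mst; rewrite /AS_adj /AS_edge -val_eqE /= modn_small; last by lia.
  have := ltn_ord w => wN mw.
  (* After v_(a+b) comes v_1, which is 0 as an ordinal but has position [a + b] on this arc. *)
  have [] : (w : nat) = m.-1 \/
      ((w : nat) = m.+1 \/ (w : nat) = 0%N /\ m.+1 = a + b) by lia.
    by move=> wE; left; apply: val_inj; rewrite /= wE modn_small //; lia.
  case=> [wE | [wE mE]]; right; apply: val_inj => /=.
    by rewrite -wE modn_small //; lia.
  by rewrite mE modnn.
have same P : (forall i j p q, P i -> i < j -> P j ->
      phi (cyc N_gt0 i) = inr p -> phi (cyc N_gt0 j) = inr q -> p = q) ->
    forall i j p q, P i -> P j ->
      phi (cyc N_gt0 i) = inr p -> phi (cyc N_gt0 j) = inr q -> p = q.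
  move=> H i j p q Pi Pj ip jq; case: (ltngtP i j) => ij.
  - exact: (H i j).
  - by apply/esym; apply: (H j i).
  - by move: jq; rewrite -ij ip => -[].
have rep r : exists2 i, 1 <= i <= a + b & phi (cyc N_gt0 i) = inr r.
  have [v vr] := phi_surj (inr r); have vN := ltn_ord v.
  case: (posnP v) => v0.
    (* Position 0 lies on neither arc, so v_1 is taken at the end of the second. *)
    exists (a + b); first by lia.
    by rewrite -vr; congr phi; apply: val_inj; rewrite /= modnn v0.
  exists (v : nat); first by lia.
  by rewrite -vr; congr phi; apply: val_inj; rewrite /= modn_small.
have s1 := same (fun i => 1 <= i <= a) _.
have s2 := same (fun i => a < i <= a + b) _.
have {}s1 i j p q := s1 (fun i j p q Pi ij Pj =>
  arc1 i j p q (proj1 (andP Pi)) ij (proj2 (andP Pj))) i j p q.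
have {}s2 i j p q := s2 (fun i j p q Pi ij Pj =>
  arc2 i j p q (proj1 (andP Pi)) ij (proj2 (andP Pj))) i j p q.
have [i0 h0 l0] := rep ord0.
have [i1 h1 l1] := rep (inord 1).
have [i2 h2 l2] := rep (inord 2).
have n01 : @ord0 2 <> inord 1 by move/(congr1 val); rewrite /= !inordK.
have n02 : @ord0 2 <> inord 2 by move/(congr1 val); rewrite /= !inordK.
have n12 : @inord 2 1 <> inord 2 by move/(congr1 val); rewrite /= !inordK.
case: (leqP i0 a) => j0; case: (leqP i1 a) => j1; case: (leqP i2 a) => j2.
all: (try by case: n01; apply: (s1 i0 i1) => //; lia);
  (try by case: n01; apply: (s2 i0 i1) => //; lia);
  (try by case: n02; apply: (s1 i0 i2) => //; lia);
  (try by case: n02; apply: (s2 i0 i2) => //; lia);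
  (try by case: n12; apply: (s1 i1 i2) => //; lia);
  (try by case: n12; apply: (s2 i1 i2) => //; lia).
Qed.

Local Open Scope ring_scope.

(** * Evaluation of e-positive functions *)

Section IntegralCoefficients.
Variables (G : sgraph) (k : nat).

(* Over any ring, since algC is not a realDomainType. *)
Definition chromatic_mpoly (R : comNzRingType) : {mpoly R[k]} :=
  \sum_(c : {ffun G -> 'I_k} | proper_colouring c) \prod_(v : G) 'X_(c v).

Lemma map_chromatic_mpoly (R S : comNzRingType) (f : {rmorphism R -> S}) :
  map_mpoly f (chromatic_mpoly R) = chromatic_mpoly S.
Proof.
rewrite rmorph_sum; apply: eq_bigr => c _; rewrite rmorph_prod.
by apply: eq_bigr => v _; rewrite /= map_mpolyX.
Qed.

Lemma map_mesym (R S : comNzRingType) (f : {rmorphism R -> S}) i :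
  map_mpoly f (@mesym k R i) = @mesym k S i.
Proof.
rewrite rmorph_sum; apply: eq_bigr => c _; rewrite rmorph_prod.
by apply: eq_bigr => v _; rewrite /= map_mpolyX.
Qed.

(** Renaming the colours by a permutation is a bijection on proper colourings. *)
Lemma chromatic_mpoly_sym (R : comNzRingType) :
  chromatic_mpoly R \is symmetric.
Proof.
apply/issymP => s; rewrite raddf_sum /=.
pose h (t : 'S_k) (c : {ffun G -> 'I_k}) := [ffun v => t (c v)].
have hK t : cancel (h t) (h t^-1%g).
  by move=> c; apply/ffunP => v; rewrite !ffunE permK.
rewrite [RHS](reindex (h s)) /=; last first.
  by exists (h s^-1%g) => c _; [rewrite hK | rewrite -{1}[s]invgK hK].
apply: eq_big => c.
  apply: eq_forallb => u; apply: eq_forallb => v; rewrite !ffunE.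
  by rewrite (inj_eq perm_inj).
move=> _; rewrite !mprodXE msymX; congr 'X_[_].
apply/mnmP => i; rewrite mnmE !mnm_sumE; apply: eq_bigr => v _.
rewrite !mnmE ffunE; congr nat_of_bool.
by apply/eqP/eqP => [->|<-]; rewrite ?permK ?permKV.
Qed.

(** A factor e_i with [i > k] vanishes in [k] variables and gives [q = 0]; otherwise the product is
    a monomial in e_1, ..., e_k. In both cases the coefficients of [q] are non-negative. *)
Lemma elementary_comp (R : realDomainType) la : is_partition la ->
  exists2 q : {mpoly R[k]}, elementary R la k = q \mPo [tuple @mesym k R i.+1 | i < k]
    & q = 0 \/ exists m, q = 'X_[m].
Proof.
case/andP => _; rewrite /elementary; elim: la => [_ | i la IHla /=].
  exists 1; first by rewrite big_nil rmorph1.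
  by right; exists 0%MM; rewrite mpolyX0.
case/andP => i_gt0 /IHla[q qE qX]; rewrite big_cons.
case: (leqP i k) => ik; last first.
  by exists 0; [rewrite mesym_geqnE // mul0r comp_mpoly0 | left].
have ik' : (i.-1 < k)%N by lia.
exists ('X_(Ordinal ik') * q).
  rewrite rmorphM /= -qE comp_mpolyXU -tnth_nth tnth_mktuple /=.
  by rewrite prednK.
case: qX => [-> | [m ->]]; first by left; rewrite mulr0.
by right; exists (U_(Ordinal ik') + m)%MM; rewrite mpolyXD.
Qed.

(* The fundamental theorem writes the chromatic polynomial over the integers as
   a polynomial in the elementary ones; uniqueness over R shows its coefficients
   to be non-negative, so that it can be evaluated in C, although R and C are
   unrelated. *)
Lemma e_positive_meval (R : realDomainType) (C : numDomainType) (x : 'I_k -> C) :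
  e_positive (chromatic_symfun R G) ->
  (forall i : 'I_k, 0 <= (@mesym k C i.+1).@[x]) ->
  0 <= (chromatic_mpoly C).@[x].
Proof.
case=> P [c [_ /allP P_part c_ge0 /(_ k)]].
rewrite -[chromatic_symfun R G k]/(chromatic_mpoly R) => XE e_ge0.
have [t [tE _]] := sym_fundamental (chromatic_mpoly_sym int).
have map_t (S : numDomainType) : chromatic_mpoly S =
    map_mpoly intr t \mPo [tuple @mesym k S i.+1 | i < k].
  rewrite -(map_chromatic_mpoly intr) -tE map_mpoly_comp; last exact: intr_inj.
  congr (_ \mPo _); apply: eq_from_tnth => i.
  by rewrite tnth_map !tnth_mktuple map_mesym.
have t_ge0 m : 0 <= t@_m.
  rewrite -(ler0z R) -mcoeff_map_mpoly.
  have [q tq q_ge0] : exists2 q : {mpoly R[k]},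
      chromatic_mpoly R = q \mPo [tuple @mesym k R i.+1 | i < k] &
      forall m, 0 <= q@_m.
    rewrite XE big_seq; elim/big_rec: _ => [|la f laP [q -> q_ge0]].
      by exists 0; rewrite ?comp_mpoly0 // => l; rewrite mcoeff0.
    have [r -> rX] := elementary_comp R (P_part la laP).
    exists (c la *: r + q) => [|l]; first by rewrite comp_mpolyD comp_mpolyZ.
    rewrite mcoeffD mcoeffZ addr_ge0 // mulr_ge0 ?c_ge0 //.
    by case: rX => [-> | [l' ->]]; rewrite ?mcoeff0 // mcoeffX ler0n.
  have -> // : map_mpoly intr t = q.
  by apply: msym_fundamental_un; rewrite -map_t.
rewrite map_t comp_mpoly_meval mevalE sumr_ge0 // => m _.
rewrite mcoeff_map_mpoly mulr_ge0 ?ler0z //.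
by apply: prodr_ge0 => i _; rewrite tnth_mktuple exprn_ge0.
Qed.

End IntegralCoefficients.

(** * The alphabet of roots of a trinomial *)

Definition psum (R : pzRingType) (k : nat) (x : 'I_k -> R) (j : nat) : R :=
  \sum_i x i ^+ j.

(** The product rule, in the form from which Newton's identities are read off. *)
Lemma deriv_prod_XsubC (R : comNzRingType) (k : nat) (x : 'I_k -> R) :
  (\prod_i ('X - (x i)%:P))^`() = \sum_i \prod_(j | j != i) ('X - (x j)%:P).
Proof.
have derivP (s : seq 'I_k) : uniq s -> (\prod_(i <- s) ('X - (x i)%:P))^`()
    = \sum_(i <- s) \prod_(j <- s | j != i) ('X - (x j)%:P).
  elim: s => [|a s IHs /= /andP[aNs us]]; first by rewrite !big_nil derivE.
  rewrite !big_cons derivM derivXsubC mul1r (IHs us) eqxx mulr_sumr /=.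
  congr (_ + _).
    rewrite [RHS]big_mkcond; apply: eq_big_seq => j js.
    by rewrite ifT //; apply: contraNneq aNs => <-.
  apply: eq_big_seq => i i_s; rewrite big_cons.
  by case: (eqVneq a i) aNs => [->|//]; rewrite i_s.
exact: derivP (index_enum_uniq _).
Qed.

(* The roots of X^(n+1) + (-1)^n X - (-1)^n, for which e_n = e_(n+1) = 1 and all
   other e_i vanish. *)
Lemma trinomial_alphabet (n : nat) : (1 < n)%N ->
  exists x : 'I_n.+1 -> algC,
    [/\ forall i : 'I_n.+1, 0 <= (@mesym n.+1 algC i.+1).@[x],
        forall j, (0 < j < n)%N -> psum x j = 0,
        psum x n = - ((-1) ^+ n * n%:R) &
        forall j, psum x (j + n.+1) = (-1) ^+ n * (psum x j - psum x j.+1)].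
Proof.
move=> n_gt1; pose s : algC := (-1) ^+ n.
have ss : s * s = 1 by rewrite -expr2 sqrr_sign.
(* By Vieta the coefficient of X^(n+1-i) is (-1)^i e_i, hence these signs. *)
pose P : {poly algC} := 'X^(n.+1) + (s *: 'X - s%:P).
have sizeQ : (size (s *: 'X - s%:P : {poly algC})%R <= 2)%N.
  apply/leq_sizeP => -[|[|j]] // _.
  by rewrite coefB coefZ coefX coefC mulr0 subr0.
have sizeP : size P = n.+2.
  by rewrite /P size_polyDl size_polyXn // (leq_ltn_trans sizeQ) // ltnS ltnW.
have leadP : lead_coef P = 1.
  rewrite /P lead_coefDl ?size_polyXn ?lead_coefXn //.
  by rewrite (leq_ltn_trans sizeQ) // ltnS ltnW.
have [r] := closed_field_poly_normal P; rewrite leadP scale1r => PE.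
have size_r : size r == n.+1 by rewrite -eqSS -sizeP PE size_prod_XsubC.
pose x := tnth (Tuple size_r); exists x.
have Px : P = \prod_i ('X - (x i)%:P) by rewrite PE (big_tuple _ _ (Tuple size_r)).
have xP i : x i ^+ n.+1 = s - s * x i.
  have P0 : P.[x i] = 0.
    by rewrite Px horner_prod (bigD1 i) //= hornerXsubC subrr mul0r.
  have : x i ^+ n.+1 + (s * x i - s) = 0.
    by rewrite -P0 hornerD hornerXn hornerD hornerN hornerZ hornerX hornerC.
  by move=> xP0; rewrite -[LHS]subr0 -xP0; ring.
have coefP i : P`_i = (i == n.+1)%:R + s * (i == 1)%N%:R - s * (i == 0)%N%:R.
  rewrite coefD coefXn coefB coefZ coefX coefC addrA; congr (_ - _).
  by case: (i == 0)%N; rewrite ?mulr1 ?mulr0.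
(* Newton's identities: the coefficients of X^(n-m) in P' and in the sum of the quotients P / (X -
   x_i) are compared. *)
have newton m : (m <= n)%N ->
    psum x m + (m == n)%:R * (s * n.+1%:R)
    = (m == 0)%N%:R * n.+1%:R + (m == n)%:R * s.
  (* As x_i is a root, P = (X^(n+1) - x_i^(n+1)) + s (X - x_i), which [Q i] divides by X - x_i. *)
  move=> mn; pose Q i : {poly algC} :=
    \sum_(l < n.+1) x i ^+ l *: 'X^(n - l) + s%:P.
  have QE i : \prod_(j | j != i) ('X - (x j)%:P) = Q i.
    apply: (mulfI (negbT (polyXsubC_eq0 (x i)))).
    rewrite -(bigD1 i (P := predT)) //= -Px /Q mulrDr.
    under eq_bigr => l _ do rewrite -mul_polyC rmorphXn /= mulrC.
    rewrite -(subrXX _ _ n.+1) -rmorphXn /= xP /P -!mul_polyC.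
    by rewrite !(rmorphB, rmorphM) /=; ring.
  have Qcoef i : (Q i)`_(n - m) = x i ^+ m + (m == n)%:R * s.
    rewrite coefD coef_sum coefC (bigD1 (Ordinal (mn : (m < n.+1)%N))) //=.
    rewrite coefZ coefXn eqxx mulr1 big1 ?addr0 => [|l lm]; last first.
      rewrite coefZ coefXn; case: eqP => [E|]; last by rewrite mulr0.
      case/eqP: lm; apply: val_inj => /=.
      by have := ltn_ord l; rewrite ltnS => ln; lia.
    congr (_ + _); rewrite subn_eq0 (_ : (n <= m)%N = (m == n)); last by lia.
    by case: eqP; rewrite ?mul1r ?mul0r.
  have := congr1 (fun p : {poly algC} => p^`()`_(n - m)) Px.
  rewrite deriv_prod_XsubC coef_sum.
  under eq_bigr => i _ do rewrite QE Qcoef.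
  rewrite big_split /= sumr_const card_ord coef_deriv coefP => E.
  have e1 : ((n - m).+1 == n.+1) = (m == 0)%N by lia.
  have e2 : ((n - m).+1 == 1)%N = (m == n) by lia.
  move: E; rewrite e1 e2 mulr0 subr0 => E.
  rewrite mulrA [_ * n.+1%:R]mulr_natr -E -mulr_natr.
  case: eqP => [m0|_]; case: eqP => [m_n|_]; first by lia.
  - by rewrite m0 subn0 /=; ring.
  - by rewrite m_n subnn /=; ring.
  - by rewrite /=; ring.
split.
(* [lift ord0] skips the leading coefficient, so [i] stands for e_(i+1). *)
- move=> i; have := mroots_coeff (Tuple size_r) (lift ord0 i).
  rewrite -[tval _]/r -PE coefP -[nat_of_ord (lift ord0 i)]/(i.+1) subSS => eE.
  have -> : (@mesym n.+1 algC i.+1).@[x] =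
      (-1) ^+ i.+1 * ((-1) ^+ i.+1 * (@mesym n.+1 algC i.+1).@[x]).
    by rewrite mulrA -expr2 sqrr_sign mul1r.
  rewrite -eE ltn_eqF ?ltnS ?leq_subr // add0r.
  have [i_n | in_n] := eqVneq (i : nat) n.
    by rewrite i_n subnn eqxx mulr0 sub0r mulr1 exprS -/s mulN1r mulrNN ss ler01.
  have [i_n | in1] := eqVneq i.+1 n.
    rewrite (_ : (n - i = 1)%N); last by lia.
    by rewrite i_n eqxx mulr0 subr0 mulr1 ss ler01.
  have i_le := ltn_ord i.
  rewrite (_ : (n - i == 1)%N = false); last by lia.
  rewrite (_ : (n - i == 0)%N = false); last by lia.
  by rewrite mulr0 subr0 mulr0.
- move=> j /andP[j_gt0 jn]; have := newton j (ltnW jn).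
  by rewrite (ltn_eqF jn) (gtn_eqF j_gt0) !mul0r !addr0.
- have := newton n (leqnn n); rewrite eqxx gtn_eqF 1?ltnW // mul0r add0r !mul1r.
  by move=> E; rewrite -/s -[LHS](addrK (s * n.+1%:R)) E -natr1; ring.
move=> j; rewrite /psum -sumrB mulr_sumr; apply: eq_bigr => i _.
by rewrite exprD xP exprS -/s; ring.
Qed.

(** * Weighted colourings of a path *)

Section PathColourings.
Variables (R : comNzRingType) (k : nat) (x : 'I_k -> R).

Definition path_proper (m : nat) (c : {ffun 'I_m.+1 -> 'I_k}) : bool :=
  [forall i : 'I_m.+1, forall j : 'I_m.+1,
     (j == i.+1 :> nat) ==> (c i != c j)].

(** Here [m] counts edges. The end colours are fixed because the rest of the graph is attached to
    the ends only. *)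
Definition path_sum (m : nat) (p q : 'I_k) : R :=
  \sum_(c : {ffun 'I_m.+1 -> 'I_k} |
      path_proper c && ((c ord0 == p) && (c ord_max == q)))
    \prod_i x (c i).

Lemma path_properP m (c : {ffun 'I_m.+1 -> 'I_k}) :
  reflect (forall i j : 'I_m.+1, j = i.+1 :> nat -> c i != c j)
          (path_proper c).
Proof.
apply: (iffP forallP) => [H i j ij | H i].
  by have /forallP/(_ j)/implyP := H i; apply; rewrite ij.
by apply/forallP => j; apply/implyP => /eqP; apply: H.
Qed.

Lemma sum_path_endpoints m (P : rel 'I_k) (F : 'I_k -> 'I_k -> R) :
  \sum_(c : {ffun 'I_m.+1 -> 'I_k} | path_proper c && P (c ord0) (c ord_max))
     F (c ord0) (c ord_max) * \prod_i x (c i)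
  = \sum_p \sum_(q | P p q) F p q * path_sum m p q.
Proof.
rewrite pair_big_dep /=.
rewrite (partition_big (fun c : {ffun 'I_m.+1 -> 'I_k} => (c ord0, c ord_max))
  (fun pq => P pq.1 pq.2)) => [|c /andP[] //].
apply: eq_bigr => -[p q] /= Ppq; rewrite mulr_sumr; apply: eq_big => c.
  rewrite -andbA xpair_eqE; congr (_ && _).
  by case: eqP => [->|]; case: eqP => [->|]; rewrite ?andbF ?Ppq.
by case/andP => _ /eqP[-> ->].
Qed.

Lemma path_sum0 p q : path_sum 0 p q = (p == q)%:R * x p.
Proof.
rewrite /path_sum; case: eqP => [<- | pq].
  rewrite mul1r (big_pred1 [ffun=> p]) => [|c].
    by rewrite big_ord1 ffunE.
  have -> : path_proper c by apply/path_properP => i j; rewrite !ord1.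
  rewrite (ord1 ord_max) andbb; apply/eqP/eqP => [cp | ->]; last by rewrite ffunE.
  by apply/ffunP => i; rewrite ffunE (ord1 i).
rewrite mul0r big_pred0 // => c; rewrite (ord1 ord_max).
case: eqP => [cp|_]; last by rewrite andbF.
by rewrite -cp in pq; case: eqP => [/pq|_]; rewrite ?andbF.
Qed.

(** A transfer-matrix step: the last vertex is removed, and the colour [r] before it only has to
    differ from [q]. *)
Lemma path_sumS m p q :
  path_sum m.+1 p q = x q * \sum_(r | r != q) path_sum m p r.
Proof.
pose h (c : {ffun 'I_m.+1 -> 'I_k}) : {ffun 'I_m.+2 -> 'I_k} :=
  [ffun i : 'I_m.+2 => if (i < m.+1)%N then c (inord i) else q].
pose h' (c : {ffun 'I_m.+2 -> 'I_k}) : {ffun 'I_m.+1 -> 'I_k} :=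
  [ffun i => c (widen_ord (leqnSn m.+1) i)].
have hw c i : h c (widen_ord (leqnSn m.+1) i) = c i.
  by rewrite ffunE /= ltn_ord inord_val.
have hm c : h c ord_max = q by rewrite ffunE /= ltnn.
have hK c : h' (h c) = c by apply/ffunP => i; rewrite ffunE hw.
rewrite /path_sum (reindex_onto h h') => [|c /andP[_ /andP[_ /eqP cq]]]; last first.
  apply/ffunP => i; rewrite !ffunE; case: ifP => im.
    by congr (c _); apply: val_inj; rewrite /= inordK.
  rewrite -cq; congr (c _); apply: val_inj => /=.
  by have := ltn_ord i; lia.
have h0 c : h c ord0 = c ord0.
  by rewrite -hw; congr (h c _); apply: val_inj.
have hpath c : path_proper (h c) = path_proper c && (c ord_max != q).
  apply/path_properP/andP => [H | [/path_properP H cq] i j ij].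
    split; last first.
      by rewrite -(hm c) -hw; apply: H.
    by apply/path_properP => i j ij; rewrite -!hw; apply: H.
  have im : (i < m.+1)%N by have := ltn_ord j; rewrite ij.
  have iE : i = widen_ord (leqnSn m.+1) (Ordinal im) by apply: val_inj.
  rewrite iE hw; case: (ltnP j m.+1) => jm.
    have jE : j = widen_ord (leqnSn m.+1) (Ordinal jm) by apply: val_inj.
    by rewrite jE hw; apply: H.
  have jE : j = ord_max by apply: val_inj => /=; have := ltn_ord j; lia.
  rewrite jE hm; move: cq; congr (c _ != q); apply: val_inj => /=.
  by rewrite jE in ij; case: ij.
rewrite (partition_big (fun c : {ffun 'I_m.+1 -> 'I_k} => c ord_max)
  (fun r => r != q)) => [|c]; last by rewrite hpath -!andbA => /and3P[].
rewrite mulr_sumr; apply: eq_bigr => r rq; rewrite mulr_sumr.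
apply: eq_big => c.
  rewrite hpath h0 hm hK !eqxx !andbT -!andbA.
  case: (path_proper c) => //=; case: (eqVneq (c ord_max) r) => [->|].
    by rewrite rq andbT.
  by rewrite !andbF.
move=> _; rewrite big_ord_recr /= hm mulrC; congr (_ * _).
by apply: eq_bigr => i _; rewrite hw.
Qed.

(* If p_j = 0 for 0 < j < m, inclusion-exclusion over the edges of the path
   leaves only the set of all edges and the sets missing exactly one. *)
Lemma path_sumE m p q : (forall j, (0 < j < m)%N -> psum x j = 0) ->
  path_sum m p q = (-1) ^+ m *
    ((p == q)%:R * x p ^+ m.+1 - \sum_(i < m) x p ^+ i.+1 * x q ^+ (m - i)).
Proof.
elim: m q => [|m IHm] q xj.
  by rewrite path_sum0 big_ord0 subr0 mul1r.
have {}IHm r : path_sum m p r = _ := IHm r (fun j jm => xj j ltac:(lia)).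
rewrite path_sumS; have -> : \sum_(r | r != q) path_sum m p r =
    \sum_r path_sum m p r - path_sum m p q.
  by rewrite [X in _ = X - _](bigD1 q) //= addrAC subrr add0r.
(* Freeing the end colour turns each mixed term into a multiple of a power sum of degree [m - i],
   between 1 and [m], which vanishes. *)
have -> : \sum_r path_sum m p r = (-1) ^+ m * x p ^+ m.+1.
  under eq_bigr => r _ do rewrite IHm.
  rewrite -mulr_sumr sumrB (bigD1 p) //= eqxx mul1r big1 => [|r rp]; last first.
    by rewrite eq_sym (negPf rp) mul0r.
  rewrite exchange_big /= big1 ?subr0 ?addr0 // => i _.
  rewrite -mulr_sumr -[X in _ * X]/(psum x _) xj ?mulr0 //.
  by have := ltn_ord i; lia.
rewrite IHm big_ord_recr /= subSnn expr1.
have -> : \sum_(i < m) x p ^+ i.+1 * x q ^+ (m.+1 - i) =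
    x q * \sum_(i < m) x p ^+ i.+1 * x q ^+ (m - i).
  rewrite mulr_sumr; apply: eq_bigr => i _.
  by rewrite subSn 1?ltnW // (exprS _ (m - i)); ring.
have -> : (p == q)%:R * x p ^+ m.+2 = x q * ((p == q)%:R * x p ^+ m.+1).
  by case: eqP => [->|]; rewrite ?mul0r ?mulr0 // !mul1r exprS.
rewrite (exprS (-1) m).
move: (\sum_(i < m) _) (x p ^+ m.+1) ((p == q)%:R : R) => S X d; ring.
Qed.

End PathColourings.

(** * Cutting the saltire into two paths *)

(* The edges of AS_(a+1, b+1) after the renaming v_(i+2) -> i of the vertices
   modulo a + b + 2: the ends of the chords are then the ends of the two blocks
   0, ..., a and a + 1, ..., a + b + 1. *)
Definition rotated_edge (a b i j : nat) : bool :=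
  [|| j == i.+1, (i == a + b.+1)%N && (j == 0)%N, (i == a + b.+1)%N && (j == a),
      (i == 0)%N && (j == a.+1) | (i == a + b.+1)%N && (j == a.+1)].

Lemma AS_edge_ordS a b (i j : 'I_(a.+1 + b.+1)) : (0 < b)%N ->
  AS_edge a.+1 b.+1 (ordS i).+1 (ordS j).+1 = rotated_edge a b i j.
Proof.
move=> b_gt0; have ordS_val (l : 'I_(a.+1 + b.+1)) :
    nat_of_ord (ordS l) = if nat_of_ord l == (a + b.+1)%N then 0%N else l.+1.
  case: eqP => E /=; first by rewrite E -addSn modnn.
  by rewrite modn_small //; have := ltn_ord l; lia.
rewrite /AS_edge !ordS_val /rotated_edge.
have := ltn_ord i; have := ltn_ord j.
by case: ifP => iE; case: ifP => jE; lia.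
Qed.

Lemma AS_adj_ordS a b (i j : 'I_(a.+1 + b.+1)) : (0 < b)%N ->
  AS_adj (a := a.+1) (b := b.+1) (ordS i) (ordS j) =
  (i != j) && (rotated_edge a b i j || rotated_edge a b j i).
Proof. by move=> b_gt0; rewrite /AS_adj !AS_edge_ordS // (inj_eq (@ordS_inj _)). Qed.

Section Blocks.
Variables (a b k : nat).

(** [ord_pred] undoes the rotation: the first block is v_2, ..., v_(a+2) and the second is v_(a+3),
    ..., v_(a+b+2), v_1. *)
Definition glue (p : {ffun 'I_a.+1 -> 'I_k} * {ffun 'I_b.+1 -> 'I_k}) :
    {ffun AS a.+1 b.+1 -> 'I_k} :=
  [ffun v : 'I_(a.+1 + b.+1) =>
     match split (ord_pred v) with inl i => p.1 i | inr j => p.2 j end].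

Definition cut (c : {ffun AS a.+1 b.+1 -> 'I_k}) :
    {ffun 'I_a.+1 -> 'I_k} * {ffun 'I_b.+1 -> 'I_k} :=
  ([ffun i => c (ordS (lshift b.+1 i))], [ffun j => c (ordS (rshift a.+1 j))]).

Lemma glue_lshift p i : glue p (ordS (lshift b.+1 i)) = p.1 i.
Proof. by rewrite ffunE ordSK (unsplitK (inl i)). Qed.

Lemma glue_rshift p j : glue p (ordS (rshift a.+1 j)) = p.2 j.
Proof. by rewrite ffunE ordSK (unsplitK (inr j)). Qed.

Lemma glueK : cancel glue cut.
Proof.
case=> c d; rewrite /cut; congr pair; apply/ffunP => i; rewrite ffunE.
  exact: glue_lshift.
exact: glue_rshift.
Qed.

Lemma cutK : cancel cut glue.
Proof.
move=> c; apply/ffunP => v; rewrite -[v]ord_predK -[ord_pred v]splitK.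
by case: (split _) => i; rewrite (glue_lshift, glue_rshift) ffunE.
Qed.

(** Two cycle edges and two chords join each end of the first block to each end of the second; the
    third chord joins the ends of the second block. *)
Lemma proper_glue c d : (0 < b)%N ->
  proper_colouring (glue (c, d)) =
  [&& path_proper c, path_proper d, d ord0 != d ord_max &
      [&& c ord0 != d ord0, c ord0 != d ord_max,
          c ord_max != d ord0 & c ord_max != d ord_max]].
Proof.
move=> b_gt0.
apply/forallP/and4P => [H | [/path_properP Hc /path_properP Hd d0m]].
  have {}H (i j : 'I_(a.+1 + b.+1)) : i != j -> rotated_edge a b i j ->
      glue (c, d) (ordS i) != glue (c, d) (ordS j).
    move=> ij e; have /forallP/(_ (ordS j))/implyP := H (ordS i); apply.
    by rewrite /= AS_adj_ordS // ij e.
  split.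
  - apply/path_properP => i j ij.
    have := H (lshift b.+1 i) (lshift b.+1 j).
    rewrite !glue_lshift; apply; first by rewrite -val_eqE /=; lia.
    by rewrite /rotated_edge /=; lia.
  - apply/path_properP => i j ij.
    have := H (rshift a.+1 i) (rshift a.+1 j).
    rewrite !glue_rshift; apply; first by rewrite -val_eqE /=; lia.
    by rewrite /rotated_edge /=; lia.
  - rewrite eq_sym; have := H (rshift a.+1 ord_max) (rshift a.+1 ord0).
    rewrite !glue_rshift; apply; first by rewrite -val_eqE /=; lia.
    by rewrite /rotated_edge /=; lia.
  apply/and4P; split.
  - have := H (lshift b.+1 ord0) (rshift a.+1 ord0).
    rewrite glue_lshift glue_rshift; apply; first by rewrite -val_eqE.
    by rewrite /rotated_edge /=; lia.
  - rewrite eq_sym; have := H (rshift a.+1 ord_max) (lshift b.+1 ord0).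
    rewrite glue_lshift glue_rshift; apply; first by rewrite -val_eqE.
    by rewrite /rotated_edge /=; lia.
  - have := H (lshift b.+1 ord_max) (rshift a.+1 ord0).
    rewrite glue_lshift glue_rshift; apply; first by rewrite -val_eqE /=; lia.
    by rewrite /rotated_edge /=; lia.
  rewrite eq_sym; have := H (rshift a.+1 ord_max) (lshift b.+1 ord_max).
  rewrite glue_lshift glue_rshift; apply; first by rewrite -val_eqE /=; lia.
  by rewrite /rotated_edge /=; lia.
case/and4P => c0d0 c0dm cmd0 cmdm.
move=> u; apply/forallP => v; apply/implyP.
rewrite -[u]ord_predK -[v]ord_predK /= AS_adj_ordS //.
wlog e : u v / rotated_edge a b (ord_pred u) (ord_pred v).
  move=> W /andP[uv /orP[e|e]]; first by apply: W; rewrite // uv e.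
  by rewrite eq_sym; apply: W; rewrite // eq_sym uv e.
case/andP => + _.
move: e; rewrite -[ord_pred u]splitK -[ord_pred v]splitK.
case: (split (ord_pred u)) => i; case: (split (ord_pred v)) => j;
  rewrite /= ?glue_lshift ?glue_rshift /rotated_edge -val_eqE /= => e ij.
- by apply: Hc; have := ltn_ord i; have := ltn_ord j; lia.
- have := ltn_ord i; have := ltn_ord j => jb ia.
  have j0 : j = ord0 by apply: val_inj => /=; lia.
  have [-> | ->] : i = ord0 \/ i = ord_max.
    have [i0 | i_a] : (i = 0 :> nat \/ i = a :> nat)%N by lia.
      by left; apply: val_inj.
    by right; apply: val_inj.
  + by rewrite j0.
  + by rewrite j0.
- have := ltn_ord i; have := ltn_ord j => ja ib.
  have im : i = ord_max by apply: val_inj => /=; lia.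
  have [-> | ->] : j = ord0 \/ j = ord_max.
    have [j0 | j_a] : (j = 0 :> nat \/ j = a :> nat)%N by lia.
      by left; apply: val_inj.
    by right; apply: val_inj.
  + by rewrite im eq_sym.
  + by rewrite im eq_sym.
- have := ltn_ord i; have := ltn_ord j => jb ib.
  have [ij1 | [ib0 j0]] :
      (j = i.+1 :> nat \/ i = b :> nat /\ j = 0 :> nat)%N by lia.
    exact: Hd.
  have -> : i = ord_max by apply: val_inj.
  have -> : j = ord0 by apply: val_inj.
  by rewrite eq_sym.
Qed.

End Blocks.

(** Here [p], [q] are the end colours of the second block and [r], [s] those of the first; once they
    are fixed, the two blocks are coloured independently. *)
Lemma AS_colouring_sum (R : comNzRingType) (a b k : nat) (x : 'I_k -> R) :
  (0 < b)%N ->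
  \sum_(c : {ffun AS a.+1 b.+1 -> 'I_k} | proper_colouring c) \prod_v x (c v) =
  \sum_p \sum_(q | p != q) (\sum_r \sum_(s | [&& r != p, r != q, s != p & s != q])
    path_sum x a r s) * path_sum x b p q.
Proof.
move=> b_gt0; rewrite (reindex (@glue a b k)) /=; last first.
  by exists (@cut a b k) => c _; [apply: glueK | apply: cutK].
pose w m (c : {ffun 'I_m.+1 -> 'I_k}) := \prod_i x (c i).
have glue_prod c d : \prod_v x (glue (c, d) v) = w a c * w b d.
  rewrite (reindex (@ordS (a.+1 + b.+1))) /=; last exact/onW_bij/ordS_bij.
  rewrite big_split_ord /=; congr (_ * _); apply: eq_bigr => i _.
    by rewrite glue_lshift.
  by rewrite glue_rshift.
pose P (p q r s : 'I_k) := [&& r != p, r != q, s != p & s != q].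
rewrite -(sum_path_endpoints x b (fun p q => p != q)
  (fun p q => \sum_r \sum_(s | P p q r s) path_sum x a r s)).
transitivity (\sum_(d | path_proper d && (d ord0 != d ord_max))
    \sum_(c | path_proper c && P (d ord0) (d ord_max) (c ord0) (c ord_max))
      w a c * w b d).
  rewrite (exchange_big_dep (fun c => path_proper c)) /=; last first.
    by move=> d c _ /andP[].
  rewrite pair_big_dep /=; apply: eq_big => -[c d] /=; last by rewrite glue_prod.
  rewrite proper_glue // /P; case: (path_proper c) => //=.
  by rewrite -!andbA; do ?bool_congr.
apply: eq_bigr => d /andP[_ dd]; rewrite -mulr_suml; congr (_ * _).
have := sum_path_endpoints x a (P (d ord0) (d ord_max)) (fun _ _ => 1).
under eq_bigr => c _ do rewrite mul1r.
move=> ->; apply: eq_bigr => r _; apply: eq_bigr => s _; exact: mul1r.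
Qed.

(** * The chromatic sum in terms of power sums *)

Lemma sum_off_pair (V : zmodType) (I : finType) (f : I -> V) p q : p != q ->
  \sum_(r | (r != p) && (r != q)) f r = \sum_r f r - f p - f q.
Proof.
move=> pq; rewrite [in RHS](bigD1 p) //= [in RHS](bigD1 q) 1?eq_sym //=.
by rewrite (addrC (f p)) addrK (addrC (f q)) addrK.
Qed.

Section PowerSums.
Variables (R : comNzRingType) (k a : nat) (x : 'I_k -> R).
Hypothesis x0 : forall j, (0 < j <= a)%N -> psum x j = 0.

(** For [0 < j <= a] the sum of [x r ^+ j] over the colours other than [p] and [q] is minus the two
    omitted terms. After [path_sumE] only degree [a.+1] leaves a power sum. *)
Lemma path_sum_off_pair p q : p != q ->
  \sum_r \sum_(s | [&& r != p, r != q, s != p & s != q]) path_sum x a r s =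
  (-1) ^+ a * (psum x a.+1 - a.+1%:R * (x p ^+ a.+1 + x q ^+ a.+1)
               - 2 * \sum_(i < a) x p ^+ (a - i) * x q ^+ i.+1).
Proof.
move=> pq; transitivity (\sum_(r | (r != p) && (r != q))
    \sum_(s | (s != p) && (s != q)) path_sum x a r s).
  rewrite [RHS]big_mkcond; apply: eq_bigr => r _; case: ifP => [/andP[rp rq]|rpq].
    by apply: eq_bigl => s; rewrite rp rq.
  by rewrite big_pred0 // => s; rewrite andbA rpq.
have off j : (0 < j <= a)%N ->
    \sum_(r | (r != p) && (r != q)) x r ^+ j = - (x p ^+ j + x q ^+ j).
  by move=> ja; rewrite sum_off_pair // -/(psum x j) x0 // sub0r opprD.
have inner r : (r != p) && (r != q) ->
    \sum_(s | (s != p) && (s != q)) path_sum x a r s = (-1) ^+ a *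
      (x r ^+ a.+1 + \sum_(i < a) x r ^+ i.+1 * (x p ^+ (a - i) + x q ^+ (a - i))).
  move=> rpq.
  have x0' j : (0 < j < a)%N -> psum x j = 0 by move=> ja; apply: x0; lia.
  under eq_bigr => s _ do rewrite (path_sumE r s x0').
  rewrite -mulr_sumr sumrB; congr (_ * (_ + _)).
    rewrite (bigD1 r) //= eqxx mul1r big1 ?addr0 // => s /andP[_ sr].
    by rewrite eq_sym (negPf sr) mul0r.
  rewrite exchange_big -sumrN /=; apply: eq_bigr => i _.
  rewrite -mulr_sumr off ?mulrN ?opprK //.
  by have := ltn_ord i; lia.
rewrite (eq_bigr _ inner) -mulr_sumr big_split sum_off_pair // exchange_big /=.
congr (_ * _); have -> : \sum_(i < a) \sum_(r | (r != p) && (r != q))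
      x r ^+ i.+1 * (x p ^+ (a - i) + x q ^+ (a - i)) =
    - \sum_(i < a) (x p ^+ i.+1 + x q ^+ i.+1) * (x p ^+ (a - i) + x q ^+ (a - i)).
  rewrite -sumrN; apply: eq_bigr => i _; rewrite -mulr_suml off ?mulNr //.
  by have := ltn_ord i; lia.
have -> : \sum_(i < a) (x p ^+ i.+1 + x q ^+ i.+1) * (x p ^+ (a - i) + x q ^+ (a - i)) =
    a%:R * (x p ^+ a.+1 + x q ^+ a.+1) +
    (\sum_(i < a) x p ^+ (a - i) * x q ^+ i.+1 +
     \sum_(i < a) x p ^+ i.+1 * x q ^+ (a - i)).
  have -> : a%:R * (x p ^+ a.+1 + x q ^+ a.+1) =
      \sum_(i < a) (x p ^+ a.+1 + x q ^+ a.+1).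
    by rewrite sumr_const card_ord mulr_natl.
  rewrite -!big_split /=; apply: eq_bigr => i _.
  have -> : a.+1 = (i.+1 + (a - i))%N by have := ltn_ord i; lia.
  by rewrite !exprD; ring.
(* Reversing one mixed sum identifies it with the other, whence the factor 2. *)
rewrite [X in _ - (_ + (_ + X))](reindex_inj rev_ord_inj) /=.
have -> : \sum_(i < a) x p ^+ (a - i.+1).+1 * x q ^+ (a - (a - i.+1)) =
    \sum_(i < a) x p ^+ (a - i) * x q ^+ i.+1.
  apply: eq_bigr => i _; have := ltn_ord i => ia.
  by congr (_ ^+ _ * _ ^+ _); lia.
by rewrite -/(psum x _) -natr1; ring.
Qed.

(** The sum over [p != q] is the sum over all pairs minus the diagonal. Over all pairs each monomial
    splits into a product of two power sums; the diagonal gives the terms multiplied by [b]. The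
    bound on [b] allows [path_sumE] for the second block. *)
Lemma AS_psum b : (0 < b <= a.+1)%N ->
  \sum_(c : {ffun AS a.+1 b.+1 -> 'I_k} | proper_colouring c) \prod_v x (c v) =
  (-1) ^+ (a + b) *
    (b%:R * (psum x a.+1 * psum x b.+1 - (4 * a + 2)%:R * psum x (a + b).+2)
     + \sum_(j < b) (a.+1%:R * (psum x (a.+1 + j.+1) * psum x (b - j)
                                + psum x j.+1 * psum x (a.+1 + (b - j)))
         + 2 * (\sum_(i < a) psum x (a - i + j.+1) * psum x (i.+1 + (b - j)))
         - psum x a.+1 * (psum x j.+1 * psum x (b - j)))).
Proof.
case/andP => b_gt0 ba; rewrite AS_colouring_sum //.
pose h m p q := \sum_(j < m) x p ^+ j.+1 * x q ^+ (m - j).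
(* Up to the global sign this is the summand for [p != q], where the first term of [path_sumE] is
   absent; the formula is extended to [p = q]. *)
pose G p q := h b p q * (a.+1%:R * (x p ^+ a.+1 + x q ^+ a.+1)
               + 2 * (\sum_(i < a) x p ^+ (a - i) * x q ^+ i.+1) - psum x a.+1).
transitivity ((-1) ^+ (a + b) * (\sum_p \sum_q G p q - \sum_p G p p)).
  rewrite -sumrB mulr_sumr; apply: eq_bigr => p _.
  rewrite [in RHS](bigD1 p) //= [G p p + _]addrC addrK mulr_sumr.
  apply: eq_big => q; first by rewrite eq_sym.
  move=> pq.
  rewrite path_sum_off_pair // path_sumE => [|j jb]; last by apply: x0; lia.
  by rewrite (negPf pq) mul0r sub0r /G -/(h b p q) exprD; ring.
congr (_ * _); rewrite addrC; congr (_ + _).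
  rewrite /G -sumrN.
  have hpp p : h b p p = b%:R * x p ^+ b.+1.
    rewrite /h -[b in b%:R]card_ord mulr_natl -sumr_const; apply: eq_bigr => j _.
    by rewrite -exprD; congr (_ ^+ _); have := ltn_ord j; lia.
  have app p : \sum_(i < a) x p ^+ (a - i) * x p ^+ i.+1 = a%:R * x p ^+ a.+1.
    rewrite -[a in a%:R]card_ord mulr_natl -sumr_const; apply: eq_bigr => i _.
    by rewrite -exprD; congr (_ ^+ _); have := ltn_ord i; lia.
  rewrite [psum x b.+1]/psum [psum x (a + b).+2]/psum !mulr_sumr -sumrB mulr_sumr.
  apply: eq_bigr => p _; rewrite hpp app.
  have -> : (a + b).+2 = (a.+1 + b.+1)%N by lia.
  by rewrite exprD natrD natrM -natr1; ring.
have psumM i j : psum x i * psum x j = \sum_p \sum_q x p ^+ i * x q ^+ j.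
  by rewrite /psum mulr_suml; apply: eq_bigr => p _; rewrite mulr_sumr.
pose T j p q := a.+1%:R * (x p ^+ (a.+1 + j.+1) * x q ^+ (b - j)
                             + x p ^+ j.+1 * x q ^+ (a.+1 + (b - j)))
         + 2 * (\sum_(i < a) x p ^+ (a - i + j.+1) * x q ^+ (i.+1 + (b - j)))
         - psum x a.+1 * (x p ^+ j.+1 * x q ^+ (b - j)).
have GT p q : G p q = \sum_(j < b) T j p q.
  rewrite /G /h /T mulr_suml; apply: eq_bigr => j _.
  have -> : \sum_(i < a) x p ^+ (a - i + j.+1) * x q ^+ (i.+1 + (b - j)) =
      x p ^+ j.+1 * x q ^+ (b - j) * \sum_(i < a) x p ^+ (a - i) * x q ^+ i.+1.
    by rewrite mulr_sumr; apply: eq_bigr => i _; rewrite !exprD; ring.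
  by rewrite !exprD; ring.
transitivity (\sum_(j < b) \sum_p \sum_q T j p q).
  rewrite [RHS]exchange_big; apply: eq_bigr => p _ /=.
  by rewrite [RHS]exchange_big; apply: eq_bigr => q _; apply: GT.
apply: eq_bigr => j _.
under [X in 2 * X]eq_bigr => i _ do rewrite psumM.
rewrite !psumM.
rewrite [X in 2 * X]exchange_big -big_split !mulr_sumr -big_split -sumrB /=.
apply: eq_bigr => p _.
rewrite [X in 2 * X]exchange_big -big_split !mulr_sumr -big_split -sumrB /=.
by apply: eq_bigr => q _.
Qed.
End PowerSums.

(** * Values on the trinomial alphabet *)

Lemma chromatic_meval (G : sgraph) (k : nat) (R : comNzRingType) (x : 'I_k -> R) :
  (chromatic_mpoly G k R).@[x] =
  \sum_(c : {ffun G -> 'I_k} | proper_colouring c) \prod_v x (c v).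
Proof.
rewrite rmorph_sum; apply: eq_bigr => c _; rewrite rmorph_prod.
by apply: eq_bigr => v _; rewrite /= mevalXU.
Qed.

Section TrinomialAlphabet.
Variables (a : nat) (x : 'I_a.+2 -> algC).
Hypothesis a_gt0 : (0 < a)%N.
Hypothesis x0 : forall j, (0 < j <= a)%N -> psum x j = 0.
Hypothesis xn : psum x a.+1 = - ((-1) ^+ a.+1 * a.+1%:R).
Hypothesis xS : forall j,
  psum x (j + a.+2) = (-1) ^+ a.+1 * (psum x j - psum x j.+1).

Lemma AS_psum_nn :
  \sum_(c : {ffun AS a.+1 a.+1 -> 'I_a.+2} | proper_colouring c)
    \prod_v x (c v) = - (a.+1%:R * a%:R * (a%:R - 1)).
Proof.
have ss : (-1) ^+ a.+1 * (-1) ^+ a.+1 = 1 :> algC by rewrite -expr2 sqrr_sign.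
have pp : psum x a.+1 * psum x a.+1 = a.+1%:R ^+ 2.
  by rewrite xn mulrNN mulrACA ss mul1r.
have p2n : psum x (a + a).+2 = a.+1%:R.
  by rewrite -!addnS xS x0 ?a_gt0 ?leqnn // sub0r xn opprK mulrA ss mul1r.
rewrite (AS_psum x0); last by rewrite a_gt0 leqnSn.
(* Power sums of degree 1 to [a] vanish. In the inner sum the two degrees add up to twice [a.+1], so
   only the term with both equal to [a.+1], that is [i = j], survives. *)
rewrite (eq_bigr (fun=> 2 * a.+1%:R ^+ 2)) => [|j _]; last first.
  have ja := ltn_ord j.
  rewrite (x0 (j := a - j)); last by lia.
  rewrite (x0 (j := j.+1)); last by lia.
  rewrite !(mulr0, mul0r) addr0 mulr0 add0r subr0 (bigD1 j) //=.
  have -> : (a - j + j.+1 = a.+1)%N by lia.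
  have -> : (j.+1 + (a - j) = a.+1)%N by lia.
  rewrite pp big1 ?addr0 // => i ij; have ia := ltn_ord i.
  have ij' : (i : nat) != j by [].
  case: (ltnP j i) => ji.
    by rewrite (x0 (j := a - i + j.+1)) ?mul0r //; lia.
  by rewrite [X in _ * X]x0 ?mulr0 //; lia.
rewrite sumr_const card_ord -(mulr_natl _ a) pp p2n.
rewrite addnn -muln2 mulnC exprM sqrrN expr1n expr1n.
by rewrite natrD natrM -(natr1 a); ring.
Qed.

Lemma AS_psum_nS :
  \sum_(c : {ffun AS a.+1 a.+2 -> 'I_a.+2} | proper_colouring c)
    \prod_v x (c v) = - (a.+1%:R * a%:R * (a%:R - 1)).
Proof.
have ss : (-1) ^+ a.+1 * (-1) ^+ a.+1 = 1 :> algC by rewrite -expr2 sqrr_sign.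
have pS : psum x a.+2 = (-1) ^+ a.+1 * a.+2%:R.
  (* The power sum of degree 0 is the number [a.+2] of variables. *)
  have := xS 0; rewrite add0n (x0 (j := 1)) ?a_gt0 // subr0 => ->; congr (_ * _).
  by rewrite /psum; under eq_bigr do rewrite expr0; rewrite sumr_const card_ord.
have pp : psum x a.+1 * psum x a.+2 = - (a.+1%:R * a.+2%:R).
  by rewrite xn pS mulNr mulrACA ss mul1r.
have p2n : psum x (a + a.+1).+2 = - (a.+1%:R + a.+2%:R).
  rewrite addnS -addSn -!addnS xS xn pS -opprD mulrN -mulrDr mulrA ss mul1r.
  by [].
rewrite (AS_psum x0); last by rewrite leqnn.
rewrite sumrB big_split /= -!mulr_sumr.
have -> : \sum_(j < a.+1) (psum x (a.+1 + j.+1) * psum x (a.+1 - j)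
      + psum x j.+1 * psum x (a.+1 + (a.+1 - j))) = - (2 * (a.+1%:R * a.+2%:R)).
  rewrite big_split /= big_ord_recl big1 ?addr0 => [|j _]; last first.
    by rewrite [X in _ * X]x0 ?mulr0 //= /bump; have := ltn_ord j; lia.
  rewrite big_ord_recr big1 ?add0r /= => [|j _]; last first.
    by rewrite x0 ?mul0r //=; have := ltn_ord j; lia.
  rewrite subSnn addn1 subn0 mulrC pp; ring.
(* The degrees add up to [a.+2]: at [j = 0] the first is 1, otherwise the second is at most [a]. *)
have -> : \sum_(j < a.+1) psum x j.+1 * psum x (a.+1 - j) = 0.
  rewrite big1 // => j _; have := ltn_ord j => ja.
  case: (posnP j) => j0; first by rewrite (x0 (j := j.+1)) ?mul0r //; lia.
  by rewrite [X in _ * X]x0 ?mulr0 //; lia.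
(* Only the degrees [a.+1] and [a.+2] survive together, in either order: for each [i] these are the
   terms [j = i] and [j = i.+1]. *)
have -> : \sum_(j < a.+1) \sum_(i < a) psum x (a - i + j.+1) *
    psum x (i.+1 + (a.+1 - j)) = - (2 * a%:R * (a.+1%:R * a.+2%:R)).
  rewrite exchange_big (eq_bigr (fun=> - (2 * (a.+1%:R * a.+2%:R)))).
    by rewrite sumr_const card_ord -mulr_natl; ring.
  move=> i _; have ia := ltn_ord i.
  have ia1 : (i < a.+1)%N by lia.
  have ia2 : (i.+1 < a.+1)%N by lia.
  rewrite (bigD1 (Ordinal ia1)) // (bigD1 (Ordinal ia2)) /=; last first.
    by rewrite -val_eqE /=; lia.
  have -> : (a - i + i.+1 = a.+1)%N by lia.
  have -> : (i.+1 + (a.+1 - i) = a.+2)%N by lia.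
  have -> : (a - i + i.+2 = a.+2)%N by lia.
  have -> : (i.+1 + (a.+1 - i.+1) = a.+1)%N by lia.
  rewrite (mulrC (psum x a.+2)) pp big1 => [|j /andP[]]; first by ring.
  rewrite -!val_eqE /= => ji jSi; have ja := ltn_ord j.
  case: (ltnP j i) => ij.
    by rewrite (x0 (j := a - i + j.+1)) ?mul0r //; lia.
  by rewrite [X in _ * X]x0 ?mulr0 //; lia.
rewrite pp p2n addnS exprS addnn -muln2 mulnC exprM sqrrN expr1n expr1n.
by rewrite natrD natrM -(natr1 a.+1) -(natr1 a); ring.
Qed.

End TrinomialAlphabet.

Local Close Scope ring_scope.

Theorem theorem3p10 (R : realDomainType) (n : nat) (hn : 3 <= n) :
  [/\ claw_contractible_free (AS n n),
      claw_contractible_free (AS n n.+1),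
      ~ e_positive (chromatic_symfun R (AS n n)) &
      ~ e_positive (chromatic_symfun R (AS n n.+1))].
Proof.
have n_gt1 : 1 < n by apply: ltnW.
have [x [x_ge0 x0 xn xS]] := trinomial_alphabet n_gt1.
case: n hn n_gt1 x x_ge0 x0 xn xS => // a a_gt1 _ x x_ge0 x0 xn xS.
have a_gt0 : 0 < a by apply: ltnW.
(* With [n = a.+1] this is - n (n - 1) (n - 2), negative because [n] is at least 3. *)
have neg : (- (a.+1%:R * a%:R * (a%:R - 1)) < 0 :> algC)%R.
  by rewrite oppr_lt0 !mulr_gt0 ?ltr0n // subr_gt0 ltr1n.
split; try by apply: AS_claw_contractible_free.
- move=> /e_positive_meval/(_ x_ge0).
  by rewrite chromatic_meval AS_psum_nn // (lt_geF neg).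
- move=> /e_positive_meval/(_ x_ge0).
  by rewrite chromatic_meval AS_psum_nS // (lt_geF neg).
Qed.
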